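(* There is an AD family $\mathcal{A}$ over a countable set which is inseparable and which codes every $\omega_1$-like partial order.
   Context: For sets $A,B$: $A\subseteq^* B$ means $A\setminus B$ is finite, and $A=^*B$ means $A\subseteq^*B$ and $B\subseteq^*A$. An AD (almost disjoint) family over a countable set $N$ is a family of infinite subsets of $N$ any two distinct members of which have finite intersection. For $n\geq 2$, a tuple $(\mathcal{L}_i:i<n)$ of families of subsets of $N$ is a pregap if $L\cap L'$ is finite whenever $L\in\mathcal{L}_i$, $L'\in\mathcal{L}_j$, $i\neq j$; a function $c:n\to\mathscr{P}(N)$ separates it if $L\subseteq^* c(i)$ for all $i<n$ and $L\in\mathcal{L}_i$, and $\bigcap_{i<n}c(i)$ is finite; it is an $n$-gap if it is a pregap and no such $c$ exists. An AD family $\mathcal{A}$ is $n$-inseparable if for any pairwise disjoint uncountable $\mathcal{L}_0,\dots,\mathcal{L}_{n-1}\subseteq\mathcal{A}$ the tuple $(\mathcal{L}_i:i<n)$ is an $n$-gap; inseparable means $2$-inseparable. A partial order $(X,\leq)$ is $\omega_1$-like if it is well-founded, $|X|=\omega_1$, and $(-\infty,x)=\{y:y<x\}$ is countable for every $x$. For $x,y\in X$, $\inf(x,y)$ denotes their greatest lower bound when it exists; $x,y$ are incompatible if there is no $z$ with $z\leq x$ and $z\leq y$. $\mathrm{pred}(x)$ denotes the set of maximal elements of $(-\infty,x)$, and $x$ is successor-like if $\mathrm{pred}(x)$ is finite and every $y<x$ satisfies $y\leq z$ for some $z\in\mathrm{pred}(x)$. An almost disjoint representation of $X$ is a pair of indexed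 families $\langle T_x\rangle_{x\in X}$, $\langle A_x\rangle_{x\in X}$ of infinite subsets of a countable set, with $x\mapsto A_x$ injective and $\{A_x\}$ an AD family, such that for all $x,y\in X$: (a) $A_x\subseteq T_x$; (b) if $y\not\leq x$ then $A_y\subseteq^* T_y\setminus T_x$; (c) if $\inf(x,y)$ exists then $T_x\cap T_y=^*T_{\inf(x,y)}$; (d) if $x$ is successor-like then $T_x\setminus\bigcup_{z\in\mathrm{pred}(x)}T_z=^*A_x$; (e) if $x,y$ are incompatible then $T_x\cap T_y=^*\emptyset$. An AD family $\mathcal{A}$ of size $\omega_1$ codes $X$ if there is a bijective indexing $\mathcal{A}=\{A_x:x\in X\}$ and sets $T_x$ such that $(\langle T_x\rangle,\langle A_x\rangle)$ is an almost disjoint representation of $X$. *)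

(* Defs.v *)
From mathcomp Require Import all_boot.
From mathcomp Require Import boolp classical_sets cardinality.
Set Implicit Arguments.
Unset Strict Implicit.
Unset Printing Implicit Defensive.
Local Open Scope classical_set_scope.

(* The countable ground set N is taken to be nat. *)

Definition subset_star (A B : set nat) : Prop := finite_set (A `\` B).
Definition eq_star (A B : set nat) : Prop := subset_star A B /\ subset_star B A.

Definition AD_family (F : set (set nat)) : Prop :=
  (forall A, F A -> infinite_set A) /\
  (forall A B, F A -> F B -> A <> B -> finite_set (A `&` B)).

(* n-tuples of families are given as L : nat -> set (set nat), indices i < n *)
Definition pregap (n : nat) (L : nat -> set (set nat)) : Prop :=
  forall i j (A B : set nat), (i < n)%N -> (j < n)%N -> i <> j ->
    L i A -> L j B -> finite_set (A `&` B).

Definition separates (n : nat) (L : nat -> set (set nat)) (c : nat -> set nat) : Prop :=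
  (forall i (A : set nat), (i < n)%N -> L i A -> subset_star A (c i)) /\
  finite_set (\bigcap_(i in [set i | (i < n)%N]) c i).

Definition is_gap (n : nat) (L : nat -> set (set nat)) : Prop :=
  pregap n L /\ ~ (exists c, separates n L c).

Definition n_inseparable (n : nat) (F : set (set nat)) : Prop :=
  forall L : nat -> set (set nat),
    (forall i, (i < n)%N -> L i `<=` F /\ ~ countable (L i)) ->
    (forall i j, (i < n)%N -> (j < n)%N -> i <> j -> L i `&` L j = set0) ->
    is_gap n L.

Definition inseparable (F : set (set nat)) : Prop := n_inseparable 2 F.

(* |T| = omega_1: T is uncountable and carries a well-order all of whose
   proper initial segments are countable. *)
Definition card_omega1 (T : Type) : Prop :=
  ~ countable [set: T] /\
  exists r : T -> T -> Prop,
    (forall x y z, r x y -> r y z -> r x z) /\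
    (forall x y, r x y \/ x = y \/ r y x) /\
    well_founded r /\
    (forall x, countable [set y | r y x]).

Section PO.
Variables (X : Type) (le : X -> X -> Prop).

Definition lt x y : Prop := le x y /\ x <> y.

Definition partial_order : Prop :=
  (forall x, le x x) /\
  (forall x y, le x y -> le y x -> x = y) /\
  (forall x y z, le x y -> le y z -> le x z).

Definition omega1_like : Prop :=
  partial_order /\ well_founded lt /\ card_omega1 X /\
  (forall x, countable [set y | lt y x]).

Definition is_inf (x y z : X) : Prop :=
  le z x /\ le z y /\ (forall w, le w x -> le w y -> le w z).

Definition incompatible (x y : X) : Prop := ~ exists z, le z x /\ le z y.

Definition predset (x : X) : set X :=
  [set y | lt y x /\ ~ exists z, lt y z /\ lt z x].

Definition successor_like (x : X) : Prop :=
  finite_set (predset x) /\ (forall y, lt y x -> exists2 z, predset x z & le y z).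

Definition AD_representation (T A : X -> set nat) : Prop :=
  (forall x, infinite_set (T x) /\ infinite_set (A x)) /\
  injective A /\
  AD_family (range A) /\
  (forall x, A x `<=` T x) /\
  (forall x y, ~ le y x -> subset_star (A y) (T y `\` T x)) /\
  (forall x y z, is_inf x y z -> eq_star (T x `&` T y) (T z)) /\
  (forall x, successor_like x ->
     eq_star (T x `\` \bigcup_(z in predset x) T z) (A x)) /\
  (forall x y, incompatible x y -> eq_star (T x `&` T y) set0).

Definition codes (F : set (set nat)) : Prop :=
  exists A T : X -> set nat, range A = F /\ AD_representation T A.

End PO.

(* Main.v *)
(* A subadditive function rho : [omega_1]^2 -> omega with finite balls
   F_n(w) = {v <= w : rho(v,w) <= n} is built by recursion, together with ranks
   s_n that are increasing on each F_n(w) and satisfy s_n(w) <= n for all large n.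
   The ground set consists of the triples (n, a, b) with a, b <= n, and A_w is
   the set of those for which {a, b} contains s_n(w) but no s_n(v) with v < w and
   rho(v,w) < n.  For v < w the set A_v cap A_w then lives on levels <= rho(v,w),
   and it has a point of level rho(v,w) once rho(v,w) is large, so that the
   family has Luzin's property and is inseparable.

   For a countable B bounded by d, put S_d(B) = union over b in B of the part of
   A_b on levels > rho(b,d).  The union is disjoint, and by subadditivity S_d(B)
   is independent of d modulo finite.  Hence B |-> S_d(B) is a homomorphism from
   the Boolean ring of countable subsets of omega_1 to P(omega)/fin sending {w}
   to A_w.  After any bijection X -> omega_1, the sets T_x := S_d((-oo, x])
   represent the order X. *)
Require Import Defs.
From mathcomp Require Import all_boot.
From mathcomp Require Import boolp classical_sets cardinality.
From mathcomp Require Import functions wochoice.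
Set Implicit Arguments.
Unset Strict Implicit.
Unset Printing Implicit Defensive.
Local Open Scope classical_set_scope.

(** * Well-founded recursion and well-orders of type $\omega_1$ *)

(** [Fix] picks a witness at each [w], the values below [w] being extended by [d0]. The first
    condition on [P] says that it only looks at values below [w], so the extension does no harm. *)
Lemma wf_choice (W D : Type) (r : W -> W -> Prop)
    (P : W -> (W -> D) -> D -> Prop) (d0 : D) :
  well_founded r ->
  (forall w f g d, (forall v, r v w -> f v = g v) -> P w f d -> P w g d) ->
  (forall w f, (forall v, r v w -> P v f (f v)) -> exists d, P w f d) ->
  exists f, forall w, P w f (f w).
Proof.
move=> wf ext step.
pose below w (rec : forall v, r v w -> D) v :=
  if pselect (r v w) is left h then rec v h else d0.
pose body w rec :=
  if pselect (exists d, P w (below w rec) d) is left h then projT1 (cid h)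
  else d0.
pose f := Fix wf (fun _ => D) body.
have fE w : f w = body w (fun v _ => f v).
  apply: (Fix_eq wf) => x g h gh; rewrite /body.
  suff -> : below x g = below x h by [].
  by apply/funext => v; rewrite /below; case: pselect.
exists f; elim/(well_founded_ind wf) => w IH.
have bE v : r v w -> below w (fun v _ => f v) v = f v.
  by rewrite /below; case: pselect.
have [d Pd] := step w f IH.
rewrite fE /body; case: pselect => [h|[]].
  by apply: ext (projT2 (cid h)) => v /bE.
by exists d; apply: ext Pd => v /bE.
Qed.

Lemma card_eqT_bijective (T U : Type) :
  ([set: T] #= [set: U])%card -> exists f : T -> U, bijective f.
Proof.
case/card_bijP => f [g fK gK].
have valTK (S : Type) : cancel (val : [set: S] -> S) (@to_setT S).
  by move=> x; apply: val_inj.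
by exists (val \o f \o @to_setT T), (val \o g \o @to_setT U) => x /=;
  rewrite valTK ?fK ?gK.
Qed.

Definition omega1_order (W : Type) (r : W -> W -> Prop) : Prop :=
  [/\ ~ countable [set: W],
      (forall x y z, r x y -> r y z -> r x z),
      (forall x y, r x y \/ x = y \/ r y x),
      well_founded r
    & forall x, countable [set y | r y x]].

Lemma uncountable_powerset_nat : ~ countable [set: set nat].
Proof.
case/countable_injP => g ginj.
have {}ginj B C : g B = g C -> B = C by apply: ginj; rewrite inE.
(* Cantor's diagonal set, transported along [g]. *)
pose S := [set n | exists2 B, g B = n & ~ B n].
have nS : ~ S (g S) by move=> h; case: (h) => B /ginj ->.
by apply: (nS); exists S.
Qed.

Lemma countable_sub (T : Type) (A B : set T) :
  A `<=` B -> countable B -> countable A.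
Proof. by move=> AB; apply: sub_countable; apply: subset_card_le. Qed.

Lemma countable_image (T U : Type) (f : T -> U) (A : set T) :
  countable A -> countable (f @` A).
Proof. by apply: sub_countable; apply: card_image_le. Qed.

Lemma countable_setU (T : Type) (A B : set T) :
  countable A -> countable B -> countable (A `|` B).
Proof.
move=> cA cB; rewrite -bigcup2E; apply: bigcup_countable => // i _.
by rewrite /bigcup2; case: i => [|[|i]].
Qed.

Lemma wf_irr (W : Type) (r : W -> W -> Prop) x : well_founded r -> ~ r x x.
Proof.
move=> wf; elim/(well_founded_ind wf): x => x IH rx; exact: (IH x rx rx).
Qed.

(** Well-order the power set of [nat] and keep the points with countable initial segment. *)
Lemma exists_omega1_order : exists (W : Type) (r : W -> W -> Prop), omega1_order r.
Proof.
have [R wo] := well_ordering_principle (set nat : eqType).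
have woT : wo_chain R predT by move=> A _; apply: wo.
have Rtot x y : R x y || R y x by apply: (wo_chainW woT).
have Ranti x y : R x y -> R y x -> x = y.
  by move=> xy yx; apply: (wo_chain_antisymmetric woT); rewrite ?inE ?xy.
have Rtrans x y z : R x y -> R y z -> R x z.
  (* Transitivity is read off the least element of $\{x,y,z\}$. *)
  move=> xy yz; have [|m [[mA mlb] _]] := wo [pred u | u \in [:: x; y; z]].
    by exists x; rewrite !inE eqxx.
  have [mx my mz] : [/\ R m x, R m y & R m z].
    by split; apply: mlb; rewrite !inE eqxx ?orbT.
  move: mA; rewrite !inE => /or3P[] /eqP E; rewrite E in mx my mz => //.
    by rewrite (Ranti _ _ xy mx).
  by rewrite -(Ranti _ _ yz my).
pose r x y := R x y /\ x <> y.
have rtrans x y z : r x y -> r y z -> r x z.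
  move=> [xy nxy] [yz nyz]; split; first exact: Rtrans yz.
  by move=> E; subst z; apply: nxy; apply: Ranti.
have rtot x y : r x y \/ x = y \/ r y x.
  have [->|nxy] := pselect (x = y); first by right; left.
  by case/orP: (Rtot x y) => h; [left|right; right]; split => // /esym.
have rmin (S : set (set nat)) : S !=set0 ->
    exists2 m, S m & forall y, r y m -> ~ S y.
  move=> [x Sx]; have [|m [[mA mlb] _]] := wo [pred u | u \in S].
    by exists x; rewrite !inE.
  exists m; first by move: mA; rewrite !inE.
  by move=> y [ym nym] Sy; apply: nym; apply: Ranti => //; apply: mlb; rewrite !inE.
have rwf : well_founded r.
  move=> x; apply: contrapT => nx.
  have [m nm mmin] := rmin [set x | ~ Acc r x] (ex_intro _ x nx).
  by apply: nm; constructor => y /mmin /contrapT.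
pose W := {x : set nat | countable [set y | r y x]}.
have svalI (u v : W) : sval u = sval v -> u = v.
  case: u v => [u hu] [v hv] /= E; subst v; congr exist; exact: Prop_irrelevance.
exists W, (fun u v : W => r (sval u) (sval v)); split.
- move=> cW; have cD : countable [set x | countable [set y | r y x]].
    apply: countable_sub (countable_image sval cW) => x cx.
    by exists (exist _ x cx).
  (* Were [W] countable, the least point with uncountable segment would have only points of [W]
     below it; if there is no such point, the whole power set would be countable. *)
  have [allc|/existsNP nall] := pselect (forall x, countable [set y | r y x]).
    by apply: uncountable_powerset_nat; apply: countable_sub cD => x _; apply: allc.
  have [m nm mmin] := rmin _ nall; apply: nm.
  by apply: countable_sub cD => y /mmin /contrapT.
- by move=> x y z; apply: rtrans.
- by move=> x y; case: (rtot (sval x) (sval y)) => [|[/svalI|]]; auto.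
- move=> w; have := rwf (sval w); move E: (sval w) => x accx.
  elim: accx w E => {}x _ IH w E; constructor => v vw.
  by apply: IH (erefl (sval v)); rewrite -E.
- move=> [x cx]; have /countable_injP[g ginj] := cx.
  apply/countable_injP; exists (g \o sval) => u v; rewrite !inE => ux vx.
  by move=> /ginj E; apply/svalI/E; rewrite inE.
Qed.

(** Otherwise the closed segments of the points of [B] would be countably many countable sets
    covering [W]. *)
Lemma omega1_order_bounded (W : Type) (r : W -> W -> Prop) (B : set W) :
  omega1_order r -> countable B -> exists d, forall b, B b -> r b d.
Proof.
move=> [unc tr tot wf seg] cB; apply: contrapT => nb; apply: unc.
apply: (@countable_sub _ _ (\bigcup_(b in B) ([set y | r y b] `|` [set b]))).
  move=> d _; apply: contrapT => nd; apply: nb; exists d => b Bb.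
  case: (tot b d) => [//|h]; case: nd; exists b => //.
  by case: h => [->|h]; [right|left].
apply: bigcup_countable => // b _.
by apply: countable_setU => //; apply: countable1.
Qed.

(** An injection is built by recursion: at [v] only the countably many values taken below [v] must
    be avoided. *)
Lemma omega1_order_card_le (V W : Type) (r : V -> V -> Prop) (q : W -> W -> Prop) :
  omega1_order r -> omega1_order q -> ([set: V] #<= [set: W])%card.
Proof.
move=> [_ _ tot wf seg] [unc _ _ _ _].
have [w0 _] : [set: W] !=set0.
  by apply/set0P/eqP => E; apply: unc; rewrite E.
have [||f fP] := @wf_choice V W r
    (fun v f d => forall u, r u v -> f u <> d) w0 wf.
- by move=> v f g d fg Pd u uv; rewrite -fg //; apply: Pd.
- move=> v f _; apply: contrapT => nd; apply: unc.
  apply: countable_sub (countable_image f (seg v)) => w _.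
  apply: contrapT => nw; apply: nd; exists w => u uv fuw.
  by apply: nw; exists u.
have finj : injective f.
  move=> u v E; case: (tot u v) => [/fP|[//|/fP]].
    by move/(_ E).
  by move/(_ (esym E)).
apply: card_le_trans (card_leT (f @` [set: V])).
by have /card_eqPle[] := inj_card_eq (in2W finj : {in [set: V] &, injective f}).
Qed.

Lemma omega1_order_bijective (V W : Type) (r : V -> V -> Prop) (q : W -> W -> Prop) :
  omega1_order r -> omega1_order q -> exists f : V -> W, bijective f.
Proof.
move=> hr hq; apply/card_eqT_bijective/card_eqPle.
by split; apply: omega1_order_card_le; eassumption.
Qed.

(** * Construction of the subadditive metric and its ranks *)

(** [c] is the running maximum of an enumeration [h] of the segment below [w]; repetitions occur,
    for instance when [w] is a successor. *)
Lemma cofinal_sequence (W : Type) (r : W -> W -> Prop) (w b0 : W) :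
  omega1_order r -> r b0 w ->
  exists c : nat -> W,
    [/\ forall i, r (c i) w,
        forall i, c i = c i.+1 \/ r (c i) (c i.+1)
      & forall b, r b w -> exists i, b = c i \/ r b (c i)].
Proof.
move=> [_ _ tot wf seg] b0w; have /countable_injP[g ginj] := seg w.
pose h n := if pselect (exists b, r b w /\ g b = n) is left H
            then projT1 (cid H) else b0.
have hw n : r (h n) w.
  by rewrite /h; case: pselect => // H; case: (projT2 (cid H)).
have hg b : r b w -> h (g b) = b.
  move=> bw; rewrite /h; case: pselect => [H|[]]; last by exists b.
  by case: (projT2 (cid H)) => hw' /ginj; apply; rewrite inE.
pose c := fix c i := if i is j.+1 then
    if pselect (r (c j) (h i)) is left _ then h i else c j else h 0.
have cw i : r (c i) w by elim: i => //= i IH; case: pselect.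
exists c; split => //.
  by move=> i /=; case: pselect => H; [right|left].
move=> b bw; exists (g b); rewrite -{1 3}(hg b bw).
case: (g b) => [|n] /=; first by left.
by case: pselect => H; [left|case: (tot (c n) (h n.+1)) => [//|[]]; auto].
Qed.

(* [f b] consists of [rho _ b] and [n |-> s n b] for the points [b] below [w];
   [d] is the candidate value at [w]. *)
Definition metric_at (W : Type) (r : W -> W -> Prop) (w : W)
    (f : W -> (W -> nat) * (nat -> nat)) (d : (W -> nat) * (nat -> nat)) : Prop :=
  [/\ forall a b, r a b -> r b w -> d.1 a <= maxn ((f b).1 a) (d.1 b),
      forall a b, r a b -> r b w -> (f b).1 a <= maxn (d.1 a) (d.1 b),
      forall a n, r a w -> d.1 a <= n -> (f a).2 n < d.2 n
    & forall k, exists N, forall n, N <= n -> d.2 n + k <= n].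

Lemma metric_at_extend (W : Type) (r : W -> W -> Prop) (w : W)
    (f : W -> (W -> nat) * (nat -> nat)) :
  omega1_order r -> (forall v, r v w -> metric_at r v f (f v)) ->
  exists d, metric_at r w f d.
Proof.
move=> hr IH; have [_ tr tot wf seg] := hr.
have [[b0 b0w]|nb] := pselect (exists b, r b w); last first.
  exists (fun=> 0, fun=> 0); split.
  - by move=> a b _ bw; case: nb; exists b.
  - by move=> a b _ bw; case: nb; exists b.
  - by move=> a n aw; case: nb; exists a.
  - by move=> k; exists k => n.
have [c [cw cS ccof]] := cofinal_sequence hr b0w.
pose rho a b := (f b).1 a; pose s n a := (f a).2 n.
pose le n a b := a = b \/ r a b /\ rho a b <= n.
have le_trans n a b d : r d w -> le n a b -> le n b d -> le n a d.
  move=> dw [->//|[ab rab]] [<-|[bd rbd]]; first by right.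
  right; split; first exact: tr bd.
  have [G1 _ _ _] := IH _ dw.
  by rewrite (leq_trans (G1 _ _ ab bd)) // geq_max rab rbd.
have le_mono m n a b : m <= n -> le m a b -> le n a b.
  by move=> mn [->|[ab rab]]; [left|right; split; rewrite // (leq_trans rab)].
have s_mono n a b : r b w -> le n a b -> s n a <= s n b.
  move=> bw [->//|[ab rab]]; have [_ _ G3 _] := IH _ bw.
  exact/ltnW/G3.
have /choice[N NP] : forall i, exists N, forall n, N <= n ->
    s n (c i) + i.+1 <= n.
  by move=> i; have [_ _ _ G4] := IH _ (cw i); apply: G4.
pose M j := N j + rho (c j) (c j.+1) + 1.
pose t i := \sum_(j < i.+1) M j.
have tS i : t i.+1 = t i + M i.+1 by rewrite /t big_ord_recr.
have Mt i : M i <= t i by rewrite /t big_ord_recr leq_addl.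
have tmono i j : i <= j -> t i <= t j.
  elim: j => [|j IHj]; first by rewrite leqn0 => /eqP->.
  rewrite leq_eqVlt => /predU1P[->//|/IHj h].
  by rewrite tS (leq_trans h) ?leq_addr.
have it i : i <= t i.
  elim: i => // i IHi; rewrite tS -addn1 leq_add // /M addn1 //.
have Nt i : N i <= t i by rewrite (leq_trans _ (Mt i)) // /M -addnA leq_addr.
have rt i : rho (c i) (c i.+1) <= t i.
  by rewrite (leq_trans _ (Mt i)) // /M addnAC leq_addl.
have chain i j n : i <= j -> t j <= n -> le n (c i) (c j).
  elim: j => [|j IHj] ij tn; first by move: ij; rewrite leqn0 => /eqP->; left.
  move: ij; rewrite leq_eqVlt => /predU1P[->|ij]; first by left.
  have tjn : t j <= n by rewrite (leq_trans _ tn) ?tmono.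
  apply: (le_trans _ _ (c j)) => //; first exact: IHj.
  by case: (cS j) => h; [left|right; split => //; apply: leq_trans (rt j) tjn].
(* [D n] is the n-ball of [w] without [w] itself: from time [t i] on it contains
   the n-ball of [c i]. *)
pose D n a := exists2 i, t i <= n & le n a (c i).
have D_mono m n a : m <= n -> D m a -> D n a.
  move=> mn [i ti h]; exists i; first exact: leq_trans mn.
  exact: le_mono h.
have D_ex a : r a w -> exists n, `[< D n a >].
  move=> aw; have [i h] := ccof a aw; exists (maxn (t i) (rho a (c i))).
  apply/asboolP; exists i; first exact: leq_maxl.
  by case: h => [->|h]; [left|right; rewrite leq_maxr].
pose e a := if pselect (exists n, `[< D n a >]) is left h then ex_minn h else 0.
have eP a n : r a w -> e a <= n <-> D n a.
  move=> aw; rewrite /e; case: pselect => [h|[]]; last exact: D_ex.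
  case: ex_minnP => m /asboolP Dm mmin; split => [mn|Dn]; first exact: D_mono Dm.
  exact/mmin/asboolP.
exists (e, fun n => \max_(i < n.+1 | t i <= n) (s n (c i)).+1); split => /=.
- move=> a b ab bw; apply/eP; first exact: tr bw.
  have /(eP b _ bw)[i ti h] := leq_maxr (rho a b) (e b).
  exists i => //; apply: le_trans h => //.
  by right; split => //; rewrite leq_maxl.
- move=> a b ab bw.
  have /(eP a _ (tr _ _ _ ab bw))[i ti hi] := leq_maxl (e a) (e b).
  have /(eP b _ bw)[j tj hj] := leq_maxr (e a) (e b).
  move: (maxn (e a) (e b)) ti tj hi hj => n ti tj hi hj.
  (* Both points lie in the [n]-ball of the later of [c i] and [c j], where the inequality is
     already known. *)
  have [l [lw al bl]] : exists l, [/\ r l w, le n a l & le n b l].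
    case/orP: (leq_total i j) => ij.
      by exists (c j); split => //; apply: (le_trans _ _ (c i)) => //; apply: chain.
    by exists (c i); split => //; apply: (le_trans _ _ (c j)) => //; apply: chain.
  have [_ G2 _ _] := IH _ lw.
  case: bl => [E|[bl rbl]].
    subst l; case: al => [E|[]] //.
    by subst b; case: (wf_irr wf ab).
  case: al => [E|[al ral]].
    by subst l; case: (wf_irr wf (tr _ _ _ ab bl)).
  by rewrite (leq_trans (G2 _ _ ab bl)) // geq_max ral rbl.
- move=> a n aw /(eP a n aw)[i ti h].
  have iltn : i < n.+1 by rewrite ltnS (leq_trans (it i)).
  apply: leq_trans (leq_bigmax_cond
    (F := fun i : 'I_n.+1 => (s n (c i)).+1) (Ordinal iltn) _) => //=.
  by rewrite ltnS s_mono.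
- move=> k; exists (t k) => n tkn.
  have kn : k <= n by rewrite (leq_trans (it k)).
  rewrite addnC -leq_subRL //; apply/bigmax_leqP => i ti.
  (* For [i <= k] the rank of [c i] is at most that of [c k], which has slack [k.+1]; for larger [i]
     the slack [i.+1] of [c i] itself suffices. *)
  rewrite leq_subRL // addnC addSnnS; case: (leqP i k) => ik.
    apply: leq_trans (NP k n (leq_trans (Nt k) tkn)).
    by rewrite leq_add2r s_mono //; apply: chain.
  apply: leq_trans (NP i n (leq_trans (Nt i) ti)).
  by rewrite leq_add2l ltnS ltnW.
Qed.

(* The slack [k] of [metric_at] is only needed to carry the recursion through. *)
Definition ordinal_metric (W : Type) (r : W -> W -> Prop)
    (rho : W -> W -> nat) (s : nat -> W -> nat) : Prop :=
  [/\ forall a b c, r a b -> r b c -> rho a c <= maxn (rho a b) (rho b c),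
      forall a b c, r a b -> r b c -> rho a b <= maxn (rho a c) (rho b c),
      forall a b n, r a b -> rho a b <= n -> s n a < s n b
    & forall a, exists N, forall n, N <= n -> s n a <= n].

Lemma exists_ordinal_metric (W : Type) (r : W -> W -> Prop) :
  omega1_order r -> exists rho s, ordinal_metric r rho s.
Proof.
move=> hr; have [_ tr _ wf _] := hr.
have [||f fP] := @wf_choice W _ r (metric_at r) (fun=> 0, fun=> 0) wf.
- move=> w f g d fg [G1 G2 G3 G4]; split => //.
  + by move=> a b ab bw; rewrite -fg //; apply: G1.
  + by move=> a b ab bw; rewrite -fg //; apply: G2.
  + by move=> a n aw; rewrite -fg //; apply: G3.
- by move=> w f; apply: metric_at_extend.
exists (fun a b => (f b).1 a), (fun n a => (f a).2 n); split.
- by move=> a b c ab bc; have [G _ _ _] := fP c; apply: G.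
- by move=> a b c ab bc; have [_ G _ _] := fP c; apply: G.
- by move=> a b n ab; have [_ _ G _] := fP b; apply: G.
- move=> a; have [_ _ _ /(_ 0)[N NP]] := fP a; exists N => n /NP.
  by rewrite addn0.
Qed.

(** * Inclusion and equality modulo finite sets *)

Lemma subset_starW (A B : set nat) : A `<=` B -> subset_star A B.
Proof. by rewrite /subset_star -setD_eq0 => ->; apply: finite_set0. Qed.

Lemma eq_star_refl (A : set nat) : eq_star A A.
Proof. by split; apply: subset_starW. Qed.

Lemma subset_star_trans (A B C : set nat) :
  subset_star A B -> subset_star B C -> subset_star A C.
Proof.
move=> AB BC; apply: sub_finite_set (_ : _ `<=` (A `\` B) `|` (B `\` C)) _.
  by move=> x [Ax nCx]; have [Bx|nBx] := pselect (B x); [right|left].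
by rewrite finite_setU.
Qed.

Lemma eq_star_trans (A B C : set nat) : eq_star A B -> eq_star B C -> eq_star A C.
Proof. by move=> [? ?] [? ?]; split; apply: (@subset_star_trans _ B). Qed.

Lemma eq_star_sym (A B : set nat) : eq_star A B -> eq_star B A.
Proof. by move=> []. Qed.

Lemma eq_star_setI (A A' B B' : set nat) :
  eq_star A A' -> eq_star B B' -> eq_star (A `&` B) (A' `&` B').
Proof.
suff sub (C C' D D' : set nat) : subset_star C C' -> subset_star D D' ->
    subset_star (C `&` D) (C' `&` D').
  by move=> [? ?] [? ?]; split; apply: sub.
move=> CC' DD'; apply: sub_finite_set (_ : _ `<=` (C `\` C') `|` (D `\` D')) _.
  move=> x [[Cx Dx] n]; have [C'x|] := pselect (C' x); last by left.
  by right; split => // D'x; apply: n.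
by rewrite finite_setU.
Qed.

Lemma eq_star_setD (A A' B B' : set nat) :
  eq_star A A' -> eq_star B B' -> eq_star (A `\` B) (A' `\` B').
Proof.
suff sub (C C' D D' : set nat) : subset_star C C' -> subset_star D' D ->
    subset_star (C `\` D) (C' `\` D').
  by move=> [? ?] [? ?]; split; apply: sub.
move=> CC' DD'; apply: sub_finite_set (_ : _ `<=` (C `\` C') `|` (D' `\` D)) _.
  move=> x [[Cx nDx] n]; have [C'x|] := pselect (C' x); last by left.
  by right; split => //; apply: contrapT => nD'x; apply: n.
by rewrite finite_setU.
Qed.

Lemma eq_star_bigcup (I : Type) (P : set I) (F G : I -> set nat) :
  finite_set P -> (forall i, P i -> eq_star (F i) (G i)) ->
  eq_star (\bigcup_(i in P) F i) (\bigcup_(i in P) G i).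
Proof.
suff sub (F' G' : I -> set nat) : finite_set P ->
    (forall i, P i -> subset_star (F' i) (G' i)) ->
    subset_star (\bigcup_(i in P) F' i) (\bigcup_(i in P) G' i).
  by move=> fP FG; split; apply: sub => // i /FG[].
move=> fP FG; apply: sub_finite_set (bigcup_finite fP FG).
move=> x [[i Pi Fx] n]; exists i => //; split => // Gx.
by apply: n; exists i.
Qed.

(** * The Luzin family and its inseparability *)

Section LuzinFamily.
Context (W : Type) (r : W -> W -> Prop) (rho : W -> W -> nat) (s : nat -> W -> nat).
Hypotheses (hr : omega1_order r) (hm : ordinal_metric r rho s).

Definition level (x : nat) : nat :=
  if (unpickle x : option (nat * nat * nat)) is Some (n, _, _) then n else 0.

(** A pair has room for the ranks of two indices, so two members can share a point. The strict bound
    [rho v w < n] leaves [v] unexcluded at level [rho v w]. *)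
Definition luzin (w : W) : set nat :=
  [set x | exists n a b, [/\ x = pickle (n, a, b), a <= n, b <= n,
    s n w = a \/ s n w = b
  & forall v, r v w -> rho v w < n -> s n v <> a /\ s n v <> b]].

Lemma level_pickle (n a b : nat) : level (pickle (n, a, b)) = n.
Proof. by rewrite /level pickleK. Qed.

(** Only finitely many triples satisfy $a, b \le n \le m$. *)
Lemma bounded_level_finite (S : set nat) m :
  (forall x, S x -> level x <= m) -> (forall x, S x -> exists w, luzin w x) ->
  finite_set S.
Proof.
move=> Sm Sl; apply: (@sub_finite_set _ _
    ((fun p : nat * nat * nat => pickle p) @` ((`I_m.+1 `*` `I_m.+1) `*` `I_m.+1))).
  move=> x Sx; have [w [n [a [b [E an bn _ _]]]]] := Sl x Sx.
  have := Sm x Sx; rewrite E level_pickle => nm; exists (n, a, b) => //=.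
  by split; first split; rewrite /= ltnS // ?(leq_trans an) ?(leq_trans bn).
by apply/finite_image/finite_setX/finite_II; apply: finite_setX; apply: finite_II.
Qed.

(** Above level [rho a b], membership in [luzin b] forbids the rank of [a], which membership in
    [luzin a] requires. *)
Lemma luzinI_level a b x :
  r a b -> luzin a x -> luzin b x -> level x <= rho a b.
Proof.
move=> ab [n [i [j [-> _ _ sa _]]]] [n' [i' [j' [E _ _ _ hb]]]].
rewrite level_pickle leqNgt; apply/negP => lt.
have [? ? ?] : [/\ n = n', i = i' & j = j'].
  by have /(pcan_inj (@pickleK _))[-> -> ->] := E.
subst n' i' j'; have [n1 n2] := hb a ab lt.
by case: sa.
Qed.

Lemma luzin_infinite w : infinite_set (luzin w).
Proof.
have [_ _ G3 G4] := hm; have [N NP] := G4 w.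
move=> fin; apply: infinite_nat.
apply: (@sub_finite_set _ _ (`I_N `|` level @` luzin w)).
  move=> n _; case: (ltnP n N) => nN; [by left|right].
  (* The doubled rank of [w] is avoided by every relevant [v], whose rank is strictly smaller. *)
  exists (pickle (n, s n w, s n w)); last exact: level_pickle.
  exists n, (s n w), (s n w); split; rewrite ?NP //; first by left.
  by move=> v vw /ltnW /(G3 _ _ _ vw) lt; split=> E; rewrite E ltnn in lt.
by rewrite finite_setU; split; [exact: finite_II|exact: finite_image].
Qed.

Lemma luzinI_finite a b : a <> b -> finite_set (luzin a `&` luzin b).
Proof.
have [_ _ tot _ _] := hr.
wlog ab : a b / r a b => [hw nab|_].
  by case: (tot a b) => [?|[//|?]]; [|rewrite setIC]; apply: hw => // /esym.
apply: (@bounded_level_finite _ (rho a b)) => x [ax bx]; last by exists a.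
exact: luzinI_level.
Qed.

Lemma luzin_inj : injective luzin.
Proof.
move=> a b E; apply: contrapT => /luzinI_finite; rewrite -E setIid.
exact: luzin_infinite.
Qed.

Lemma luzin_AD : AD_family (range luzin).
Proof.
split=> [_ [a _ <-]|_ _ [a _ <-] [b _ <-] nab]; first exact: luzin_infinite.
by apply: luzinI_finite => E; apply: nab; rewrite E.
Qed.

(** Two points of the ball are at distance at most [m], so [s m] is injective on it, with values
    below [s m w]. *)
Lemma ball_finite w m : finite_set [set v | r v w /\ rho v w <= m].
Proof.
have [_ _ tot _ _] := hr; have [_ G2 G3 _] := hm.
apply/finite_set_leP; exists (s m w).
have : {in [set v | r v w /\ rho v w <= m] &, injective (s m)}.
  move=> u v; rewrite !inE => -[uw um] [vw vm] E.
  have key x y : r x y -> r y w -> rho x w <= m -> rho y w <= m -> s m x < s m y.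
    move=> xy yw xm ym; apply: G3 => //.
    by rewrite (leq_trans (G2 _ _ _ xy yw)) // geq_max xm ym.
  case: (tot u v) => [uv|[//|vu]].
    by have := key _ _ uv vw um vm; rewrite E ltnn.
  by have := key _ _ vu uw vm um; rewrite E ltnn.
move=> /inj_card_eq/card_eqPle[_ /card_le_trans]; apply; apply: subset_card_le.
by move=> _ [v [vw vm] <-]; apply: G3.
Qed.

(* The Luzin property: beyond finitely many [v], the common point of level
   [rho v w] lies outside [S]. *)
Lemma luzin_meet w (S : set nat) :
  finite_set S -> finite_set [set v | r v w /\ luzin v `&` luzin w `<=` S].
Proof.
move=> fS; have [_ tr tot _ _] := hr; have [_ G2 G3 G4] := hm.
have [N NP] := G4 w.
have [m mP] : exists m, forall x, S x -> level x <= m.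
  have /finite_seqP[l ->] := fS; exists (\max_(x <- l) level x) => x xl.
  by rewrite (big_rem x) //= leq_maxl.
apply: sub_finite_set (ball_finite w (maxn N m)) => v /= [vw sub].
split=> //; rewrite leqNgt gtn_max; apply/negP => /andP[Nn mn].
set n := rho v w in Nn mn.
have svw : s n v < s n w by apply: G3.
have swn : s n w <= n by apply/NP/ltnW.
have : S (pickle (n, s n v, s n w)).
  apply: sub; split; exists n, (s n v), (s n w);
    (split => //; first by rewrite (leq_trans (ltnW svw))); [by left| |by right|].
  - move=> u uv uvn; have lt := G3 _ _ _ uv (ltnW uvn).
    by split=> E; [move: lt|have := ltn_trans lt svw]; rewrite E ltnn.
  (* The rank of [u] is below that of [w]. It also differs from that of [v]: [u] is not [v], since
     [rho v w = n], and the two are at distance at most [n], so their ranks are strictly ordered. *)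
  - move=> u uw uwn; have lt := G3 _ _ _ uw (ltnW uwn).
    split=> E; last by move: lt; rewrite E ltnn.
    case: (tot u v) => [uv|[uv|vu]].
    + have : rho u v <= n.
        by rewrite (leq_trans (G2 _ _ _ uv vw)) // geq_max leqnn (ltnW uwn).
      by move/(G3 _ _ _ uv); rewrite E ltnn.
    + by move: uwn; rewrite uv ltnn.
    + have : rho v u <= n.
        by rewrite (leq_trans (G2 _ _ _ vu uw)) // geq_max leqnn (ltnW uwn).
      by move/(G3 _ _ _ vu); rewrite E ltnn.
by move/mP; rewrite level_pickle leqNgt mn.
Qed.

(** Each finite error [luzin w] minus [c] lies below some [m], and countably many [m] cannot split
    [L] into countable pieces. *)
Lemma uncountable_trace (L : set (set nat)) (c : set nat) :
  L `<=` range luzin -> ~ countable L -> (forall A, L A -> subset_star A c) ->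
  exists m, ~ countable [set w | L (luzin w) /\ luzin w `\` c `<=` `I_m].
Proof.
move=> Lr uL Lc; apply: contrapT => nm; apply: uL.
apply: (@countable_sub _ _ (luzin @` \bigcup_(m in [set: nat])
    [set w | L (luzin w) /\ luzin w `\` c `<=` `I_m])).
  move=> A LA; have [w _ wA] := Lr A LA; exists w => //.
  have /finite_seqP[l lE] : finite_set (luzin w `\` c) by apply: Lc; rewrite wA.
  exists (\max_(x <- l) x).+1 => //=; split; first by rewrite wA.
  by move=> x; rewrite lE /= => xl; rewrite ltnS (big_rem x) //= leq_maxl.
apply/countable_image/bigcup_countable => // m _.
by apply: contrapT => h; apply: nm; exists m.
Qed.

(** Given a separation, fix uniform error bounds on uncountable parts of both families. A point [w]
    of one part above infinitely many points of the other meets all of those inside one finite set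
    [S], against [luzin_meet]. *)
Lemma luzin_inseparable : inseparable (range luzin).
Proof.
move=> L hL disj; split.
  move=> i j A B i2 j2 ij LA LB; apply: luzin_AD.2.
  - exact: (hL i i2).1.
  - exact: (hL j j2).1.
  - move=> E; have : (L i `&` L j) A by split; rewrite // E.
    by rewrite disj.
move=> [c [cL cfin]]; have [_ tr tot _ seg] := hr.
have [L0 uL0] := hL 0 isT; have [L1 uL1] := hL 1 isT.
have [m0 u0] := uncountable_trace L0 uL0 (cL 0 ^~ isT).
have [m1 u1] := uncountable_trace L1 uL1 (cL 1 ^~ isT).
set I0 := [set w | _] in u0; set I1 := [set w | _] in u1.
have [f [finj fI]] : exists f : nat -> W, injective f /\ forall n, I0 (f n).
  have /infiniteP/card_leP[g] : infinite_set I0 by move=> /finite_set_countable.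
  exists (fun n => val (g (to_setT n))); split; last by move=> n; apply: set_valP.
  by move=> i j /val_inj E; apply: (congr1 val) (inj _ _ E); rewrite inE.
have [d dP] := omega1_order_bounded hr (countable_image f (countableP [set: nat])).
have [w I1w dw] : exists2 w, I1 w & r d w.
  apply: contrapT => nw; apply: u1.
  apply: (@countable_sub _ _ ([set y | r y d] `|` [set d])).
    move=> w I1w; case: (tot w d) => [|[|dw]]; [by left|by right|].
    by case: nw; exists w.
  by apply: countable_setU => //; apply: countable1.
apply: infinite_nat.
pose S := `I_m0 `|` `I_m1 `|` (\bigcap_(i in [set i | i < 2]) c i).
have fS : finite_set S by rewrite !finite_setU; split=> //; split; exact: finite_II.
have := luzin_meet w fS; set J := [set v | _] => fJ.
have -> : [set: nat] = f @^-1` J.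
  apply/seteqP; split=> // n _ /=; split; first by apply: tr dw; apply: dP; exists n.
  move=> x [fx wx]; have [c0|nc0] := pselect (c 0 x); last first.
    by left; left; apply: (fI n).2.
  have [c1|nc1] := pselect (c 1 x); last by left; right; apply: I1w.2.
  by right => -[|[|]].
by apply: finite_preimage => // i j _ _; apply: finj.
Qed.

(** * Spreads as a Boolean homomorphism modulo finite *)

Definition spread (d : W) (B : set W) : set nat :=
  [set x | exists b, [/\ B b, luzin b x & rho b d < level x]].

(** For [r a b], a common point has level at most [rho a b], hence at most the larger of [rho a d]
    and [rho b d]. *)
Lemma spread_disjoint d a b x : r a d -> r b d ->
  luzin a x -> luzin b x -> rho a d < level x -> rho b d < level x -> a = b.
Proof.
have [_ _ tot _ _] := hr; have [_ G2 _ _] := hm.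
wlog ab : a b / r a b => [hw ad bd ax bx ha hb|].
  case: (tot a b) => [|[//|]] h; first exact: (hw a b).
  exact/esym/(hw b a).
move=> ad bd ax bx ha hb; have := luzinI_level ab ax bx.
rewrite leqNgt => /negP[]; apply: leq_ltn_trans (G2 _ _ _ ab bd) _.
by rewrite gtn_max ha hb.
Qed.

(** For [r d e] the two inequalities for [rho] make the thresholds [rho b d] and [rho b e]
    equivalent on levels above [rho d e], uniformly in [b]. *)
Lemma spread_indep d e (B : set W) :
  (forall b, B b -> r b d) -> (forall b, B b -> r b e) ->
  eq_star (spread d B) (spread e B).
Proof.
have [_ _ tot _ _] := hr; have [G1 G2 _ _] := hm.
suff sub d' e' (d'e' : r d' e') : (forall b, B b -> r b d') ->
    eq_star (spread d' B) (spread e' B).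
  move=> Bd Be; case: (tot d e) => [h|[->|h]]; first exact: sub.
    exact: eq_star_refl.
  exact/eq_star_sym/sub.
move=> Bd; split.
  apply: (@bounded_level_finite _ (rho d' e')) => x [[b [Bb bx bd]] nx]; last by exists b.
  rewrite leqNgt; apply/negP => lt; apply: nx; exists b; split => //.
  by apply: leq_ltn_trans (G1 _ _ _ (Bd b Bb) d'e') _; rewrite gtn_max bd.
apply: (@bounded_level_finite _ (rho d' e')) => x [[b [Bb bx be]] nx]; last by exists b.
rewrite leqNgt; apply/negP => lt; apply: nx; exists b; split => //.
by apply: leq_ltn_trans (G2 _ _ _ (Bd b Bb) d'e') _; rewrite gtn_max be.
Qed.

Lemma spread1 d w : eq_star (luzin w) (spread d [set w]).
Proof.
split; last first.
  by apply: subset_starW => x [b [-> ? _]].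
apply: (@bounded_level_finite _ (rho w d)) => x [wx nx]; last by exists w.
by rewrite leqNgt; apply/negP => lt; apply: nx; exists w.
Qed.

Lemma spread_sub d (B C : set W) : B `<=` C -> spread d B `<=` spread d C.
Proof. by move=> BC x [b [/BC Cb bx bd]]; exists b. Qed.

Lemma spreadI d (B C : set W) :
  (forall b, B b -> r b d) -> (forall c, C c -> r c d) ->
  spread d B `&` spread d C = spread d (B `&` C).
Proof.
move=> Bd Cd; apply/seteqP; split=> [x [[b [Bb bx bd]] [c [Cc cx cd]]]|x h].
  have E := spread_disjoint (Bd b Bb) (Cd c Cc) bx cx bd cd; subst c.
  by exists b.
by split; apply: spread_sub h => ? [].
Qed.

Lemma spread0 d : spread d set0 = set0.
Proof. by apply/seteqP; split=> // x [b []]. Qed.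

Lemma spread_bigcup d (I : Type) (P : set I) (F : I -> set W) :
  spread d (\bigcup_(i in P) F i) = \bigcup_(i in P) spread d (F i).
Proof.
apply/seteqP; split=> [x [b [[i Pi Fb] bx bd]]|x [i Pi [b [Fb bx bd]]]].
  by exists i => //; exists b.
by exists b; split => //; exists i.
Qed.

Lemma spreadD d (B C : set W) :
  (forall b, B b -> r b d) -> (forall c, C c -> r c d) ->
  spread d B `\` spread d C = spread d (B `\` C).
Proof.
move=> Bd Cd; apply/seteqP; split=> [x [[b [Bb bx bd]] nC]|x [b [[Bb nCb] bx bd]]].
  by exists b; split => //; split => // Cb; apply: nC; exists b.
split; first by exists b.
move=> [c [Cc cx cd]]; apply: nCb.
by rewrite (spread_disjoint (Bd b Bb) (Cd c Cc) bx cx bd cd).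
Qed.

(** * Coding an arbitrary order *)

(** Over a common bound [e] each clause becomes a Boolean identity between the sets [dn x], the
    images of the principal down-sets. *)
Lemma luzin_codes (X : Type) (le : X -> X -> Prop) (phi : X -> W) :
  omega1_like le -> bijective phi -> codes le (range luzin).
Proof.
move=> [[lexx [leanti letrans]] [_ [_ ctbl]]] [psi phiK psiK].
pose dn x := phi @` [set y | le y x].
have cdn x : countable (dn x).
  apply: countable_image; apply: (@countable_sub _ _ ([set y | lt le y x] `|` [set x])).
    by move=> y yx; have [->|] := pselect (y = x); [right|left].
  by apply: countable_setU => //; apply: countable1.
have bnd (B : set W) : countable B -> exists d, forall b, B b -> r b d.
  exact: omega1_order_bounded.
have /choice[d dP] : forall x, exists d, forall b, dn x b -> r b d.
  by move=> x; apply: bnd.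
(* Adding [A x] makes the inclusion in [T x] exact and changes the spread only finitely ([TE]). *)
pose A x := luzin (phi x); pose T x := A x `|` spread (d x) (dn x).
have dnx x : dn x (phi x) by exists x.
have AS e x (B : set W) : B (phi x) -> subset_star (A x) (spread e B).
  move=> Bx; apply: subset_star_trans (spread1 e (phi x)).1 _.
  by apply/subset_starW/spread_sub => _ ->.
have TE e x : (forall b, dn x b -> r b e) -> eq_star (T x) (spread e (dn x)).
  move=> xe; apply: eq_star_trans (spread_indep (dP x) xe); split.
    by rewrite /subset_star setDUl setDv setU0; apply: AS.
  by apply: subset_starW => y; right.
have bnd3 x y z : exists e, [/\ forall b, dn x b -> r b e,
    forall b, dn y b -> r b e & forall b, dn z b -> r b e].
  have [e eP] := bnd _ (countable_setU (countable_setU (cdn x) (cdn y)) (cdn z)).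
  by exists e; split=> b h; apply: eP; [left; left|left; right|right].
have phiI x y : dn x (phi y) -> le y x by move=> [z zx /(can_inj phiK) <-].
have Tinf x y z : is_inf le x y z -> eq_star (T x `&` T y) (T z).
  move=> [zx [zy zmax]]; have [e [xe ye ze]] := bnd3 x y z.
  apply: eq_star_trans (eq_star_setI (TE e x xe) (TE e y ye)) _.
  rewrite spreadI //; apply: eq_star_trans (eq_star_sym (TE e z ze)).
  rewrite (_ : _ `&` _ = dn z); first exact: eq_star_refl.
  apply/seteqP; split=> [_ [[u ux <-] /phiI uy]|_ [u uz <-]].
    by exists u => //=; apply: zmax.
  by split; exists u => //=; apply: letrans uz _.
have Tinc x y : incompatible le x y -> eq_star (T x `&` T y) set0.
  move=> inc; have [e [xe ye _]] := bnd3 x y y.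
  apply: eq_star_trans (eq_star_setI (TE e x xe) (TE e y ye)) _.
  rewrite spreadI // (_ : _ `&` _ = set0) ?spread0; first exact: eq_star_refl.
  by apply/seteqP; split=> // _ [[u ux <-] /phiI uy]; apply: inc; exists u.
have Tout x y : ~ le y x -> subset_star (A y) (T y `\` T x).
  move=> nyx; have [e [xe ye _]] := bnd3 x y y.
  apply: subset_star_trans (eq_star_sym (eq_star_setD (TE e y ye) (TE e x xe))).1.
  by rewrite spreadD //; apply: AS; split=> // /phiI.
have Tsucc x : successor_like le x ->
    eq_star (T x `\` \bigcup_(z in predset le x) T z) (A x).
  move=> [pfin pcof]; have [e [xe _ _]] := bnd3 x x x.
  have lex z : predset le x z -> le z x by move=> [[]].
  have ze z : predset le x z -> forall b, dn z b -> r b e.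
    move=> zp _ [u uz <-]; apply: xe; exists u => //=.
    exact: letrans uz (lex z zp).
  (* Finiteness of [predset le x] lets the finite errors of the [T z] be summed; what remains is
     that [dn x] minus all [dn z] is the singleton of [phi x]. *)
  apply: eq_star_trans (eq_star_setD (TE e x xe)
    (eq_star_bigcup pfin (fun z zp => TE e z (ze z zp)))) _.
  rewrite -spread_bigcup spreadD //; last by move=> b [z zp]; apply: ze zp b.
  apply: eq_star_sym; rewrite (_ : _ `\` _ = [set phi x]); first exact: spread1.
  apply/seteqP; split=> [_ [[u ux <-] nu]|_ ->].
    congr phi; apply: contrapT => nux; apply: nu.
    by have [//|z zp uz] := pcof u; exists z => //; exists u.
  split; first exact: dnx.
  by move=> [z zp /phiI xz]; case: zp => [[zx nzx] _]; apply: nzx; apply: leanti.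
have Ainf x : infinite_set (A x) by apply: luzin_infinite.
have rA : range A = range luzin.
  apply/seteqP; split=> [_ [x _ <-]|_ [w _ <-]]; first by exists (phi x).
  by exists (psi w); rewrite // /A psiK.
exists A, T; split; first by [].
split; first by move=> x; split=> //; apply: sub_infinite_set (Ainf x) => y; left.
split; first by move=> x y /luzin_inj /(can_inj phiK).
split; first by rewrite rA; apply: luzin_AD.
by split=> [x y|]; first left.
Qed.

End LuzinFamily.

Theorem mainTheorem3 :
  exists F : set (set nat),
    AD_family F /\ inseparable F /\
    (forall (X : Type) (le : X -> X -> Prop), omega1_like le -> codes le F).
Proof.
have [W [r hr]] := exists_omega1_order.
have [rho [s hm]] := exists_ordinal_metric hr.
exists (range (luzin r rho s)); split; first exact: luzin_AD hr hm.
split; first exact: luzin_inseparable hr hm.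
move=> X le leX; have [_ [_ [[unc [q [tr [tot [wf seg]]]]] _]]] := leX.
(* The family is already fixed; only this bijection depends on the order [X]. *)
have [phi phi_bij] : exists phi : X -> W, bijective phi.
  by apply: (@omega1_order_bijective _ _ q r).
exact: (luzin_codes hr hm leX phi_bij).
Qed.
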